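(* Let $D$ be a link diagram. Let $s_0$ be a Kauffman state of $D$ such that all the blue scars of $s_0D$ are grouped into $k$ ladders $H_1,\dots,H_k$ of heights $h_1,\dots,h_k\ge1$. Assume that the periphery number of each ladder is one. Let $\mu_1,\dots,\mu_k$ be integers with $0<\mu_i\le h_i$ for all $i=1,\dots,k$. Then $d(X)=2V$, where $$X=s(\mu_1,\dots,\mu_k;+)$$ and $$V=\sum_{\substack{i\in\{1,\dots,k\}\\ \mu_i \text{ even},\ \mu_i<h_i}}(-1)^{\mu_1+\dots+\mu_{i-1}}\, s(\mu_1,\dots,\mu_{i-1},1+\mu_i,\mu_{i+1},\dots,\mu_k;C_i^{0-}).$$ Moreover, $V\ne0$ if and only if there exists $r\in\{1,\dots,k\}$ such that $\mu_r$ is even and $\mu_r<h_r$.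
   Context: Khovanov complex, over a (nonzero) commutative ring $R$ with unit. A Kauffman state of a diagram $D$ is a map $s:\mathrm{Cro}(D)\to\{A,B\}$ on the set of crossings. $sD$ denotes the collection of disjoint simple closed curves (''circles'') obtained by smoothing each crossing according to its label, where the $A$-smoothing joins the two regions swept by rotating the overstrand counterclockwise and the $B$-smoothing joins the other two; at each crossing one keeps a small chord (''scar'') joining the two resulting arcs, blue for an $A$-label and red for a $B$-label. An enhanced state is a state together with a sign $\pm$ on each circle of $sD$; $\theta(s)=\#(+)-\#(-)$, $i(s)=$ number of $B$-labels, $j(s)=i(s)+\theta(s)$. $C^{i,j}(D)$ is the free $R$-module generated by enhanced states with $i(s)=i$, $j(s)=j$. An enhanced state $t$ is adjacent to $s$ if $i(t)=i(s)+1$, $j(t)=j(s)$, the labels agree except at one crossing $x$ where $s(x)=A$, $t(x)=B$, and the signs of the common circles agree (so mergings are $(+,+)\mapsto +$, $(+,-),(-,+)\mapsto -$, and splittings are $+\mapsto(+,-)$ or $(-,+)$, $-\mapsto(-,-)$). With the crossings numbered, $d(s)=\sum_t (-1)^{k(s,t)}t$ over all $t$ adjacent to $s$, where $k(s,t)$ is the number of crossings previous to the change crossing $x$ having a $B$-label in $s$. Ladders. A (blue) ladder of $s_0D$ of height $h\ge1$ is a maximal disc of $\mathbb R^2$ containing exactly two arcs (of the same circle or of different circles) and $h$ parallel blue scars (the steps) joining the two arcs; maximal means that no larger such disc contains an extra parallel blue scar. Cutting (breaking) a ladder means replacing the two arcs by two caps, one at each end of the ladder, as when changing a step to red. Cut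 all the ladders of $s_0D$; the one or two resulting circles touching the two ends of $H_i$ form the periphery of $H_i$, and their number (1 or 2) is the periphery number of $H_i$. Notation. The crossings of $D$ are ordered so that first come those of $H_1$ (in the order of its steps along the ladder), then those of $H_2$, etc., and finally the remaining ones. For subsets $M_i\subset\{1,\dots,h_i\}$ of sizes $\mu_i>0$, $s(M_1,\dots,M_k;\,)$ is the Kauffman state obtained from $s_0$ by changing the steps in $M_i$ of $H_i$ to red, for every $i$. In it, $C_i^j$ ($1\le j\le\mu_i-1$) is the intermediate circle between the $j$-th and $(j+1)$-th red steps of $H_i$, and $C_i^0$ is the periphery circle of $H_i$ touching the first red step of $M_i$ (if the periphery number is one it also touches the last one). $s(\mu_1,\dots,\mu_k;+)$ is the sum, over all $M_1,\dots,M_k$ with $|M_t|=\mu_t$, of the enhanced states with underlying state $s(M_1,\dots,M_k;\,)$ in which all circles have sign $+$; $s(\mu_1,\dots,\mu_k;C_i^{j-})$ is the analogous sum in which all circles have sign $+$ except $C_i^j$, which has sign $-$. *)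

(* Defs.v *)
From mathcomp Require Import all_boot all_order all_algebra.

Set Implicit Arguments.
Unset Strict Implicit.
Unset Printing Implicit Defensive.

Import GRing.Theory.
Local Open Scope ring_scope.

Definition classes (T : finType) (e : rel T) : {set {set T}} :=
  [set [set y | connect e x y] | x : T].

(** * Link diagrams in the plane

   A diagram is given by its combinatorics (a planar-diagram code).  Every
   crossing has four half-edges ("darts"), numbered 0, 1, 2, 3 counterclockwise,
   so that 0, 2 lie on the understrand and 1, 3 on the overstrand.  [edge]
   sends a dart to the other end of its edge.  [loop] lists the components
   without crossings.  A dart also names
   - the corner between itself and the next dart counterclockwise;
   - the side of its edge which is on the left when leaving the crossing.
   [side] gives the region of the plane on each side of each edge or loop, and
   [outer] is the unbounded region.  Regions are not assumed to be discs, as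
   the diagram need not be connected. *)

Record pre_diagram := PreDiagram {
  cro : finType;
  loop : finType;
  region : finType;
  edge : cro * 'I_4 -> cro * 'I_4;
  side : (cro * 'I_4) + (loop * bool) -> region;
  outer : region
}.

Notation dart D := (cro D * 'I_4)%type.
(* The points of the projection, up to moving along an open edge or a loop. *)
Notation point D := ((cro D * 'I_4) + loop D)%type.

Section PreDiagram.
Variable D : pre_diagram.

Definition turn (a : dart D) : dart D := (a.1, ordS a.2).
Definition turn_back (a : dart D) : dart D := (a.1, ord_pred a.2).
Definition opp (a : dart D) : dart D := turn (turn a).

(* Walk along [a] to the next corner of the region on the left. *)
Definition face (a : dart D) : dart D := turn_back (edge a).

Definition glue : rel (point D) := fun u v =>
  match u, v with
  | inl a, inl b => (b == edge a) || (b == turn a)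
  | _, _ => false
  end.

Definition touches (u : point D) (r : region D) : bool :=
  match u with
  | inl a => side (inl a) == r
  | inr l => (side (inr (l, false)) == r) || (side (inr (l, true)) == r)
  end.

Definition incident : rel (point D + region D) := fun p q =>
  match p, q with
  | inl u, inl v => glue u v
  | inl u, inr r => touches u r
  | inr r, inl u => touches u r
  | inr _, inr _ => false
  end.

(* Planarity: the sphere is connected and has Euler characteristic 2.  There
   are #|cro| vertices and 2 * #|cro| edges, so Euler's formula for a plane
   graph with c components, V - E + F = 1 + c, reads F = V + c + 1 (a loop adds
   nothing to V - E).  Together with connectedness it forces each component to
   have genus 0 and the incidence graph between components and regions to be
   a tree. *)
Record planar : Prop := Planar {
  edgeK : involutive (@edge D);
  edge_neq : forall a : dart D, edge a != a;
  side_face : forall a : dart D, side (inl (face a)) = side (inl a);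
  sphere_connected : forall p q : point D + region D, connect incident p q;
  euler : #|region D| = (#|cro D| + #|classes glue| + 1)%N
}.

End PreDiagram.

Record link_diagram := LinkDiagram {
  diagram :> pre_diagram;
  diagram_planar : planar diagram
}.

(** * Kauffman states and the Khovanov complex *)

(* [false] is the label A, [true] is the label B. *)
Definition state (D : pre_diagram) := {ffun cro D -> bool}.

Section Khovanov.
Variable D : pre_diagram.
Implicit Types (s : state D) (x y : cro D) (a : dart D).

(* Counterclockwise rotation of the overstrand (darts 1, 3) sweeps the corners
   1-2 and 3-0.  The A-smoothing joins them, so its arcs are 0-1 and 2-3; the
   arcs of the B-smoothing are 1-2 and 3-0. *)
Definition smoothing s a : dart D :=
  if odd a.2 == s a.1 then turn a else turn_back a.

Definition along s : rel (point D) := fun u v =>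
  match u, v with
  | inl a, inl b => (b == edge a) || (b == smoothing s a)
  | _, _ => false
  end.

Definition circle s (u : point D) : {set point D} :=
  [set v | connect (along s) u v].

Definition circles s : {set {set point D}} := classes (along s).

(* A sign on each circle is encoded by the set of the circles signed +. *)
Definition enhanced :=
  {p : state D * {set {set point D}} | p.2 \subset circles p.1}.

Definition st (u : enhanced) : state D := (val u).1.
Definition plus (u : enhanced) : {set {set point D}} := (val u).2.
Definition minus (u : enhanced) : {set {set point D}} :=
  circles (st u) :\: plus u.

Definition theta (u : enhanced) : int := #|plus u|%:Z - #|minus u|%:Z.
Definition ideg (u : enhanced) : nat := #|[set x | st u x]|.
Definition jdeg (u : enhanced) : int := (ideg u)%:Z + theta u.

(* [t] is adjacent to [u], with change crossing [x]. *)
Definition adjacent x (u t : enhanced) : bool :=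
  [&& ideg t == (ideg u + 1)%N, jdeg t == jdeg u,
      ~~ st u x, st t x,
      [forall y, (y != x) ==> (st t y == st u y)] &
      [forall C in circles (st u) :&: circles (st t),
         (C \in plus t) == (C \in plus u)]].

(* The direct sum of all the modules C^{i,j}(D). *)
Definition chain (R : comNzRingType) := {ffun enhanced -> R^o}.

Definition gen (R : comNzRingType) (u : enhanced) : chain R :=
  [ffun t => (t == u)%:R].

(* A numbering of the crossings is given by the list of all of them. *)
Definition previous_B (num : seq (cro D)) x s : nat :=
  #|[set y | s y & (index y num < index x num)%N]|.

(* The change crossing is determined by [u] and [t], so the double sum runs
   once over each state adjacent to [u]. *)
Definition d_gen (R : comNzRingType) (num : seq (cro D)) (u : enhanced) :
    chain R :=
  \sum_x \sum_(t | adjacent x u t)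
    (-1) ^+ previous_B num x (st u) *: gen R t.

Definition d (R : comNzRingType) (num : seq (cro D)) (c : chain R) : chain R :=
  \sum_u c u *: d_gen R num u.

Definition all_plus s : enhanced :=
  exist _ (s, circles s) (subxx (circles s)).

Definition all_plus_but s (C : {set point D}) : enhanced :=
  exist _ (s, circles s :\ C) (subD1set (circles s) C).

End Khovanov.

(** * Ladders *)

Section Ladders.
Variable D : pre_diagram.
Implicit Types (s : state D) (a b : dart D) (H : seq (dart D)).

(* The region at the corners [a] and [b] is a disc bounded by two edges which
   join the crossings of [a] and [b]; nothing else of the diagram lies inside
   or on its boundary. *)
Definition bigon a b : bool :=
  [&& face a == b,
      [set z | side z == side (inl a)] == [set inl a; inl b] &
      side (inl a) != outer D].

(* A blue scar runs between the arcs 0-1 and 2-3, so its two sides are the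
   corners 1 and 3.  A ladder is recorded by its steps, in order, a step being
   given by the corner by which the ladder leaves it; the ladder enters it by
   the opposite corner.  Consecutive steps and the edges joining them bound a
   rectangle.  A ladder disc contains no other scar, whatever its colour. *)
Definition parallel a b : bool := bigon a (opp b).

Definition crossings_of H : seq (cro D) := [seq a.1 | a <- H].

Definition ladder_disc s H : bool :=
  [&& H != [::], uniq (crossings_of H),
      all (fun a => ~~ s a.1 && odd a.2) H & sorted parallel H].

Definition ladder s H : Prop :=
  ladder_disc s H /\ forall H', ladder_disc s H' -> infix H H' -> H' = H.

(* The corners at the two ends of a ladder, where the caps are drawn. *)
Definition ends H : seq (dart D) :=
  if H is a :: H' then [:: opp a; last a H'] else [::].

Variable k : nat.
Implicit Types (Hs : 'I_k -> seq (dart D)) (M : {ffun 'I_k -> {set cro D}}).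

Definition ladder_crossings Hs : seq (cro D) :=
  flatten [seq crossings_of (Hs i) | i <- enum 'I_k].

(* Changing every step of every ladder to red draws the two caps of each
   ladder.  It also creates small circles inside the ladder discs, between
   consecutive steps, but they do not touch the ends. *)
Definition cut s Hs : state D := [ffun x => s x || (x \in ladder_crossings Hs)].

Definition periphery s Hs (i : 'I_k) : {set {set point D}} :=
  [set C | C \in [seq circle (cut s Hs) (inl a) | a <- ends (Hs i)]].

(* The subset M_i is given by the crossings of the chosen steps of H_i. *)
Definition choice_of Hs (mu : 'I_k -> nat) M : bool :=
  [forall i, (M i \subset crossings_of (Hs i)) && (#|M i| == mu i)].

Definition redden s M : state D := [ffun x => s x || [exists i, x \in M i]].

(* C_i^0: the circle passing by the entry corner of the first red step. *)
Definition circle0 s Hs M (i : 'I_k) : {set point D} :=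
  if [seq a <- Hs i | a.1 \in M i] is a :: _
  then circle (redden s M) (inl (opp a)) else set0.

Variable R : comNzRingType.

Definition sum_plus s Hs (mu : 'I_k -> nat) : chain D R :=
  \sum_(M | choice_of Hs mu M) gen R (all_plus (redden s M)).

Definition sum_minus0 s Hs (mu : 'I_k -> nat) (i : 'I_k) : chain D R :=
  \sum_(M | choice_of Hs mu M)
    gen R (all_plus_but (redden s M) (circle0 s Hs M i)).

End Ladders.

(* Main.v *)
Require Import Defs.
From mathcomp Require Import all_boot all_order all_algebra.
From mathcomp Require Import zify.

Set Implicit Arguments.
Unset Strict Implicit.
Unset Printing Implicit Defensive.

Import GRing.Theory.
(* Here [opp] is the half-turn of darts, not the opposite of a fraction. *)
Import Defs.
Local Open Scope ring_scope.

(** Call the B-crossings of a state red and the others blue.  The all-plus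
state over [s] has two neighbours for each blue step [x]: over the state [t]
obtained by making [x] red they carry the sign minus on one of the two circles
into which [x] splits a circle of [s].  Collect the terms of [d X] by the state
[t].  Let [i] be the ladder of [x]; in [t] it has [m = 1 + mu i] red steps
x_1, ..., x_m, separated by circles C^0, ..., C^m.  Restoring x_j to blue
contributes the terms with minus on C^(j-1) and on C^j, with the sign (-1)^(j-1)
times the sign (-1)^(mu_1 + ... + mu_(i-1)) of the earlier ladders.  The sum
over j telescopes to C^0 + (-1)^(m-1) C^m.  As the periphery number is one,
C^m = C^0: the terms cancel if [mu i] is odd and double if [mu i] is even.

The topology behind this is in three facts on circles.
- If the two arcs of a red crossing lie on different circles, making it blue
  joins these two circles and changes no other one ([connect_mergeP]).  This
  determines the neighbours of an all-plus state ([adjacent_merge]).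
- Between two consecutive red steps, a ladder disc contains a whole circle
  ([zone_closed]).  So in a ladder with two red steps or more, the two arcs of
  each red step lie on different circles ([reds_separate]), and the first fact
  applies to all the steps which matter.
- Making a step blue only joins circles, so the two ends of a ladder, which
  are on one circle when all the ladders are cut, remain on one circle as long
  as each ladder keeps a red step ([ends_connected]).

Finally, the terms of [V] sit over pairwise different states, since the numbers
of red steps in a state reveal the index [i].  Each coefficient is then 1 or
-1, and [V] vanishes only if its index set is empty. *)

(** * Darts and smoothings *)

Section Darts.
Variable D : pre_diagram.
Implicit Types (s t : state D) (x y : cro D) (a b p : dart D).

Lemma turn_backE a : turn_back a = turn (opp a).
Proof. by case: a => x [[|[|[|[|i]]]] Hi] //; congr pair; apply/val_inj. Qed.

Lemma opp_opp : involutive (@opp D).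
Proof. by case=> x [[|[|[|[|i]]]] Hi] //; congr pair; apply/val_inj. Qed.

Lemma odd_turn a : odd (turn a).2 = ~~ odd a.2.
Proof. by case: a => x [[|[|[|[|i]]]] Hi]. Qed.

Lemma odd_opp a : odd (opp a).2 = odd a.2.
Proof. by rewrite /opp !odd_turn negbK. Qed.

Lemma turn_neq a : turn a != a.
Proof.
by apply: contraTneq isT => /(congr1 (fun a => odd a.2)); rewrite odd_turn;
  case: odd.
Qed.

Lemma opp_neq a : opp a != a.
Proof. by case: a => x [[|[|[|[|i]]]] Hi]; rewrite xpair_eqE eqxx. Qed.

Lemma turn_opp_neq a : turn (opp a) != a.
Proof.
by apply: contraNneq (turn_neq a) => /(congr1 (@turn D)) <-;
  rewrite -/(opp (opp a)) opp_opp.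
Qed.

Lemma dart_at a b : a.1 = b.1 ->
  [|| b == a, b == turn a, b == opp a | b == turn (opp a)].
Proof.
case: a b => x i [y j] /= <-; rewrite !xpair_eqE !eqxx /=.
by case: i j => [[|[|[|[|i]]]] Hi] [[|[|[|[|j]]]] Hj].
Qed.

Lemma smoothingE s a :
  smoothing s a = if odd a.2 == s a.1 then turn a else turn (opp a).
Proof. by rewrite /smoothing turn_backE. Qed.

Lemma smoothing1 s a : (smoothing s a).1 = a.1.
Proof. by rewrite smoothingE; case: ifP. Qed.

Lemma smoothing_inv s : involutive (smoothing s).
Proof.
move=> a; rewrite [smoothing s (_ s a)]smoothingE smoothing1
  [smoothing s a]smoothingE.
case E: (odd a.2 == s a.1); rewrite odd_turn ?odd_opp; move: E;
  case: odd; case: (s _) => //= _; exact: opp_opp.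
Qed.

Lemma smoothing_neq s a : smoothing s a != a.
Proof. by rewrite smoothingE; case: ifP; rewrite ?turn_neq ?turn_opp_neq. Qed.

(** Steps of ladders are odd darts, so the arcs of a step [a] are [a -- turn a]
and [opp a -- turn (opp a)] when it is red; when it is blue, the arcs join its
two sides instead. *)
Lemma smoothing_red s a : odd a.2 -> s a.1 -> smoothing s a = turn a.
Proof. by move=> oa sa; rewrite smoothingE oa sa. Qed.

Lemma smoothing_blue s a : odd a.2 -> ~~ s a.1 -> smoothing s a = turn (opp a).
Proof. by move=> oa /negPf sa; rewrite smoothingE oa sa. Qed.

End Darts.

(** * Merging two circles *)

Lemma even_involutive (T : finType) (f : T -> T) (A : {set T}) :
  involutive f -> (forall a, f a != a) -> (forall a, a \in A -> f a \in A) ->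
  ~~ odd #|A|.
Proof.
move=> fK fN fA.
have clA : fclosed f A.
  by apply: intro_closed;
    [exact: fconnect_sym (inv_inj fK)|move=> a b /eqP <-; exact: fA].
have ordA : A \subset order_set f 2.
  apply/subsetP => a _; rewrite inE; apply/eqP.
  by apply: (@order_cycle _ f [:: a; f a]);
    rewrite ?inE /= ?fK ?eqxx // andbT inE eq_sym fN.
by rewrite -(fcard_order_set (inv_inj fK) ordA clA) muln2 odd_double.
Qed.

Section Along.
Variable D : link_diagram.
Implicit Types (s t : state D) (x y : cro D) (a b p : dart D) (u v : point D).

Lemma edge_inv : involutive (@edge D).
Proof. exact: edgeK (diagram_planar D). Qed.

Lemma along_edge s a : along s (inl a) (inl (edge a)).
Proof. by rewrite /= eqxx. Qed.

Lemma along_smoothing s a : along s (inl a) (inl (smoothing s a)).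
Proof. by rewrite /= eqxx orbT. Qed.

Lemma along_csym s : connect_sym (along s).
Proof.
apply: sym_connect_sym => -[a|l] [b|m] //=.
by rewrite ![a == _]eq_sym (inv_eq edge_inv) (inv_eq (@smoothing_inv _ s)).
Qed.

Lemma mem_circle s u v : (v \in circle s u) = connect (along s) u v.
Proof. by rewrite inE. Qed.

Lemma circle_eq s u v : (circle s u == circle s v) = connect (along s) u v.
Proof.
apply/eqP/idP => [Euv|uv]; first by rewrite -mem_circle Euv mem_circle connect0.
by apply/setP => w; rewrite !mem_circle (same_connect (@along_csym s) uv).
Qed.

Lemma circlesP s (C : {set point D}) : reflect (exists u, C = circle s u)
    (C \in circles s).
Proof. by apply: (iffP imsetP) => [[u _ ->]|[u ->]]; exists u. Qed.

Lemma circle_in s u : circle s u \in circles s.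
Proof. by apply/circlesP; exists u. Qed.

Definition flip s x : state D := [ffun y => (y == x) (+) s y].

Lemma flipK x : involutive (flip^~ x).
Proof. by move=> s; apply/ffunP => y; rewrite !ffunE addKb. Qed.

Lemma flip_at s x : flip s x x = ~~ s x.
Proof. by rewrite ffunE eqxx. Qed.

Lemma flip_away s x y : y != x -> flip s x y = s y.
Proof. by rewrite ffunE => /negPf->. Qed.

Lemma smoothing_flip s x a : a.1 != x -> smoothing (flip s x) a = smoothing s a.
Proof. by move=> ax; rewrite /smoothing flip_away. Qed.

Section Merge.
Variables (t : state D) (p : dart D).
Hypotheses (odd_p : odd p.2) (t_p : t p.1).
Hypothesis sep_p : ~~ connect (along t) (inl p) (inl (opp p)).

(** Removing the arc between [p] and [turn p] from its circle leaves a path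
between these darts.  By parity: let [K] be the part of the circle reachable
from [p] without using an arc at the crossing of [p].  The edges pair the darts
of [K].  If [turn p] were not in [K], the arcs would pair all the darts of [K]
except [p]. *)
Lemma arc_reroute : connect (along (flip t p.1)) (inl p) (inl (turn p)).
Proof.
pose g : rel (dart D) := fun a b =>
  (b == edge a) || ((a.1 != p.1) && (b == smoothing t a)).
pose K := [set a | connect g p a].
have Kg a b : g a b -> a \in K -> b \in K.
  by rewrite !inE => gab pa; apply: connect_trans pa (connect1 gab).
have Kalong t' : (forall a, a.1 != p.1 -> smoothing t' a = smoothing t a) ->
    forall a, a \in K -> connect (along t') (inl p) (inl a).
  move=> tt' a; rewrite inE => /connectP[q].
  elim/last_ind: q a => [|q b IHq] a; first by move=> _ ->.
  rewrite rcons_path last_rcons => /andP[/IHq pq gqb] ->.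
  apply: connect_trans (pq _ erefl) (connect1 _).
  case/orP: gqb => [/eqP->|/andP[/tt'<- /eqP->]]; first exact: along_edge.
  exact: along_smoothing.
have KC := Kalong t (fun _ _ => erefl).
apply: (Kalong _ (@smoothing_flip t p.1)); apply: contraT => turnK.
have evK : ~~ odd #|K|.
  apply: (even_involutive edge_inv (edge_neq (diagram_planar D))) => a.
  by apply: Kg; rewrite /g eqxx.
have evK' : ~~ odd #|K :\ p|.
  apply: (even_involutive (@smoothing_inv _ t) (@smoothing_neq _ t)) => a.
  rewrite !in_setD1 => /andP[ap aK].
  have a1p : a.1 != p.1.
    apply: contraNneq sep_p => /esym /dart_at /or4P[] /eqP Ea;
      move: aK ap turnK;
      rewrite Ea ?eqxx //; first by move=> ->.
      by move/KC.
    have <- : smoothing t (opp p) =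
      turn (opp p) by rewrite smoothing_red ?odd_opp.
    move/KC=> pa _ _; apply: connect_trans pa _; rewrite along_csym.
    exact/connect1/along_smoothing.
  apply/andP; split; last by apply: Kg aK; rewrite /g a1p eqxx orbT.
  by apply: contraNneq a1p => <-; rewrite smoothing1.
by move: evK; rewrite (cardsD1 p) inE connect0 /= evK'.
Qed.

End Merge.

Section MergeCircles.
Variables (t : state D) (p : dart D).
Hypotheses (odd_p : odd p.2) (t_p : t p.1).
Hypothesis sep_p : ~~ connect (along t) (inl p) (inl (opp p)).

Let s := flip t p.1.
Let C1 := circle t (inl p).
Let C2 := circle t (inl (opp p)).

Lemma connect_merge1 : subrel (connect (along t)) (connect (along s)).
Proof.
have sep' : ~~ connect (along t) (inl (opp p)) (inl (opp (opp p))).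
  by rewrite opp_opp along_csym.
apply: connect_sub => -[a|//] [b|//] /orP[]/eqP->;
  first exact/connect1/along_edge.
have [a1p|/smoothing_flip<-] := eqVneq a.1 p.1;
  last exact/connect1/along_smoothing.
have K1 := arc_reroute odd_p t_p sep_p.
have K2 : connect (along s) (inl (opp p)) (inl (turn (opp p))).
  by apply: (arc_reroute _ _ sep'); rewrite ?odd_opp.
have S1 : smoothing t p = turn p by apply: smoothing_red.
have S2 : smoothing t (opp p) = turn (opp p) by apply: smoothing_red;
  rewrite ?odd_opp.
case/or4P: (dart_at (esym a1p)) => /eqP->;
  rewrite -?S1 -?S2 ?smoothing_inv ?S1 ?S2 //.
  by rewrite along_csym.
by rewrite along_csym.
Qed.

(** Blue arcs at [p] only link the four darts there, which lie on [C1] or [C2].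
Conversely, each lost red arc can be replaced by the rest of its circle, and
a blue arc links [C1] to [C2]. *)
Lemma connect_mergeP u v : connect (along s) u v =
  connect (along t) u v || (u \in C1 :|: C2) && (v \in C1 :|: C2).
Proof.
have C12 w : w \in C1 :|: C2 -> connect (along s) (inl p) w.
  case/setUP; rewrite inE => /connect_merge1 //; apply: connect_trans.
  have sp : ~~ s p.1 by rewrite flip_at t_p.
  apply: connect_trans (connect1 (along_smoothing s p)) _.
  rewrite (smoothing_blue odd_p sp) along_csym.
  apply: connect_merge1; apply: connect1.
  by rewrite -(smoothing_red (s := t)) ?odd_opp // along_smoothing.
apply/idP/orP; last first.
  case=> [/connect_merge1 //|/andP[/C12 pu /C12]].
  by apply: connect_trans; rewrite along_csym.
case/connectP=> q; elim/last_ind: q v => [|q w IHq] v; first by move=> _ ->;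
  left.
rewrite rcons_path last_rcons => /andP[/IHq/(_ erefl) + sqw ->] {v}.
have stepC z w' : along t z w' -> (w' \in C1 :|: C2) = (z \in C1 :|: C2).
  move=> tzw; rewrite !inE.
  by rewrite !(same_connect_r (@along_csym t) (connect1 tzw)).
set z := last u q in sqw *.
(* A step of [s] which is not a step of [t] is an arc at the crossing of [p]. *)
have [tzw|] := boolP (along t z w).
  case=> [uz|/andP[uC zC]]; first by left;
    apply: connect_trans uz (connect1 tzw).
  by right; rewrite uC (stepC _ _ tzw).
case: z sqw => [a|//]; case: w => [b|//] sab nab.
have a1p : a.1 = p.1.
  apply: contraNeq nab => a1p; move: sab.
  by rewrite /along smoothing_flip.
have b1p : b.1 = p.1.
  case/orP: sab nab => /eqP->; first by rewrite along_edge.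
  by rewrite smoothing1.
have inC c : c.1 = p.1 -> inl c \in C1 :|: C2.
  have S1 : smoothing t p = turn p by apply: smoothing_red.
  have S2 : smoothing t (opp p) = turn (opp p) by apply: smoothing_red;
    rewrite ?odd_opp.
  move/esym/dart_at/or4P=> -[] /eqP->;
    rewrite -?S1 -?S2 !inE ?connect0 ?orbT //.
    by rewrite (connect1 (along_smoothing _ _)).
  by rewrite (connect1 (along_smoothing _ _)) orbT.
case=> [ua|/andP[uC _]]; right; rewrite inC // andbT //.
rewrite !inE in ua *.
have := inC _ a1p; rewrite !inE.
by rewrite !(same_connect_r (@along_csym t) ua).
Qed.

Lemma neq_C12 : C1 != C2.
Proof. by rewrite circle_eq. Qed.

Lemma merged_notin : C1 :|: C2 \notin circles t.
Proof.
apply: contra sep_p => /circlesP[u EC].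
have up : connect (along t) u (inl p) by rewrite -mem_circle -EC !inE connect0.
rewrite -(same_connect (@along_csym t) up) -mem_circle -EC !inE.
by rewrite connect0 orbT.
Qed.

Lemma circles_merge :
  circles s = (C1 :|: C2) |: (circles t :\ C1 :\ C2).
Proof.
have inC u : (u \in C1 :|: C2) = (circle t u == C1) || (circle t u == C2).
  by rewrite !circle_eq in_setU !mem_circle ![connect _ u _]along_csym.
have circleC u : u \in C1 :|: C2 -> circle s u = C1 :|: C2.
  move=> uC; apply/setP => v; rewrite mem_circle connect_mergeP uC /=.
  apply/orb_idl => uv; move: uC.
  by rewrite !inE !(same_connect_r (@along_csym t) uv).
have circleN u : u \notin C1 :|: C2 -> circle s u = circle t u.
  by move=> uC; apply/setP => v;
    rewrite !mem_circle connect_mergeP (negPf uC) orbF.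
apply/setP => C; rewrite !inE; apply/circlesP/idP => [[u ->]|].
  have [/circleC->|uC] := boolP (u \in C1 :|: C2); first by rewrite eqxx.
  rewrite circleN // circle_in andbT.
  by move: uC; rewrite inC negb_or => /andP[-> ->]; rewrite orbT.
case/orP=> [/eqP->|/and3P[nC2 nC1 /circlesP[u EC]]].
  by exists (inl p); rewrite circleC // !inE connect0.
by exists u; rewrite circleN // inC -EC negb_or nC1.
Qed.

Lemma common_circles : circles s :&: circles t = circles t :\ C1 :\ C2.
Proof.
rewrite circles_merge setIUl; apply/setP => C; rewrite !inE.
have [->|_] /= := eqVneq C (C1 :|: C2).
  by rewrite (negPf merged_notin) !andbF.
by case: (C \in circles t); rewrite ?andbF ?andbT.
Qed.

Lemma card_circles_merge : #|circles t| = #|circles s|.+1.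
Proof.
rewrite circles_merge cardsU1 !inE (negPf merged_notin) !andbF /= add1n.
rewrite (cardsD1 C1) circle_in (cardsD1 C2 (circles t :\ C1)) !inE.
by rewrite circle_in eq_sym neq_C12.
Qed.

Lemma card_red_merge : #|[set x | t x]| = #|[set x | s x]|.+1.
Proof.
rewrite (cardsD1 p.1) inE t_p add1n; congr _.+1; apply: eq_card => x.
by rewrite !inE ffunE; have [->|_] := eqVneq x p.1; rewrite ?t_p.
Qed.

(** Going from [s] to [t] raises the homological degree and the number of
circles by one, so the sign minus must occur exactly once for [jdeg] to be
preserved. *)
Lemma jdeg_merge (P : {set {set point D}}) (PC : P \subset circles t) :
  (jdeg (exist _ (t, P) PC : enhanced D) == jdeg (all_plus s)) =
    (#|circles t :\: P| == 1%N).
Proof.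
rewrite /jdeg /theta /ideg /minus /st /plus /= setDv cards0 card_red_merge.
have := cardsID P (circles t); rewrite (setIidPr PC) card_circles_merge.
move: #|P| #|circles t :\: P| #|circles s| #|[set x | s x]| => m n c i Emn.
by apply/eqP/eqP; lia.
Qed.

(** The circle signed minus cannot be common to [s] and [t], whence it is [C1]
or [C2]. *)
Lemma adjacent_merge (w : enhanced D) :
  adjacent p.1 (all_plus s) w =
    (w == all_plus_but t C1) || (w == all_plus_but t C2).
Proof.
apply/idP/orP.
  case/and5P=> _ /eqP jw _ wp /andP[/forallP away /forallP common].
  have Est : st w = t.
    apply/ffunP => y; have [->|yp] := eqVneq y p.1; first by rewrite wp t_p.
    by have := implyP (away y) yp; rewrite flip_away // => /eqP.
  case: w => [[t' P] /= PC] in jw wp away common Est *.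
  rewrite /st /= in Est; subst t'.
  have subP : circles t :\ C1 :\ C2 \subset P.
    apply/subsetP => C; rewrite -common_circles => CI.
    by have := implyP (common C) CI;
      rewrite /plus /= (subsetP (subsetIl _ _) _ CI) => /eqP.
  have := eqxx (jdeg (all_plus s)).
  rewrite -{1}jw jdeg_merge => /cards1P[C EC].
  have : C \in circles t :\: P by rewrite EC set11.
  case/setDP => Ct CP.
  have EP : P = circles t :\ C by rewrite -EC setDDr setDv set0U;
    apply/esym/setIidPr.
  have : C \notin circles t :\ C1 :\ C2 by apply: contra CP => /(subsetP subP).
  rewrite !inE Ct andbT negb_and !negbK => /orP[]/eqP E; [right|left];
    by apply/eqP/val_inj; rewrite /= EP E.
have adj C : C \in circles t -> C \in [:: C1; C2] ->
    adjacent p.1 (all_plus s) (all_plus_but t C).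
  move=> Ct C12; apply/and5P; split.
  - by rewrite /ideg /st /= card_red_merge addn1.
  - rewrite jdeg_merge setDDr setDv set0U.
    by rewrite (setIidPr _) ?cards1 ?sub1set.
  - by rewrite flip_at t_p.
  - by [].
  apply/andP; split; first by apply/forallP => y; apply/implyP => yp;
    rewrite flip_away.
  apply/forallP => C'; apply/implyP; rewrite common_circles => C'I.
  have : C' \in circles s by move: C'I; rewrite -common_circles => /setIP[].
  move: C'I C12; rewrite !inE => /and3P[C'2 C'1 ->] /orP[]/eqP->;
    rewrite ?C'1 ?C'2 => ->//.
by case=> /eqP->; apply: adj; rewrite ?circle_in // !inE eqxx ?orbT.
Qed.

End MergeCircles.
End Along.

(** * Circles between the red steps of a ladder *)

Section FilterSplit.
Variables (T : eqType) (P : pred T).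
Implicit Types (s r : seq T).

Lemma filter_eq_cons s a r : filter P s = a :: r ->
  exists q s', [/\ s = q ++ a :: s', all (predC P) q, P a & filter P s' = r].
Proof.
elim: s => //= b s IHs;
  case: ifPn => [Pb [<- <-]|nPb /IHs[q [s' [-> qP aP <-]]]].
  by exists [::], s.
by exists (b :: q), s'; split=> //=; rewrite nPb.
Qed.

Lemma filter_eq_cat s r1 r2 : filter P s = r1 ++ r2 ->
  exists s1 s2, [/\ s = s1 ++ s2, filter P s1 = r1 & filter P s2 = r2].
Proof.
elim: r1 s => [|a r1 IHr] s /=; first by exists [::], s.
case/filter_eq_cons=> q [s' [-> + aP /IHr[s1 [s2 [-> <- <-]]]]].
rewrite all_predC has_filter negbK => /eqP qP.
exists (q ++ a :: s1), s2; split=> //; first by rewrite -catA.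
by rewrite filter_cat /= aP qP.
Qed.

Lemma filter_eq_nil s : filter P s = [::] -> all (predC P) s.
Proof. by move=> Es; rewrite all_predC has_filter Es. Qed.

End FilterSplit.

Section Ladders.
Variable D : link_diagram.
Implicit Types (s t : state D) (x y : cro D) (a b c : dart D)
    (H Q : seq (dart D)).

(** The two edges bounding the rectangle between the steps [a] and [b]. *)
Definition next_step a b :=
  (edge a == turn (opp b)) && (edge (turn a) == opp b).

(** The region left by [a] has only the corners [a] and [opp b].  Walking along
it from [a] leads to [opp b], and a walk from [opp b] cannot return to [opp b]
since [face] is injective; so it closes up at [a]. *)
Lemma parallel_next_step a b : a.1 != b.1 -> parallel a b -> next_step a b.
Proof.
move=> ab /and3P[/eqP fab /eqP sides _].
have edgeE p : edge p = turn (face p).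
  by rewrite /face turn_backE -/(opp (opp (edge p))) opp_opp.
have nab : opp b != a by apply: contraNneq ab => <-.
have : inl (face (opp b)) \in [set z | side z == side (inl a)].
  by rewrite inE (side_face (diagram_planar D)) -fab
    (side_face (diagram_planar D)).
have inlI : injective (@inl (dart D) (loop D * bool)) by move=> c d [].
rewrite sides !inE !(inj_eq inlI) => /orP[]/eqP fb.
  by rewrite /next_step edgeE fab eqxx -fb -edgeE edge_inv eqxx.
have := congr1 (@edge D)
  (etrans (congr1 (@turn D) fab) (congr1 (@turn D) (esym fb))).
by rewrite -!edgeE !edge_inv => /eqP; rewrite eq_sym (negPf nab).
Qed.

Definition step_chain H :=
  [&& uniq (crossings_of H), all (fun a => odd a.2) H & sorted next_step H].

Lemma ladder_step_chain s H : ladder_disc s H -> step_chain H.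
Proof.
case/and4P=> _ uH /allP oH pH; apply/and3P; split=> //.
  by apply/allP => a /oH /andP[].
have : sorted [rel a b | a.1 != b.1] H.
  by apply: pairwise_sorted; move: uH; rewrite uniq_pairwise pairwise_map.
case: H pH {oH uH} => //= a H pH neqH.
have : path [rel a b | (a.1 != b.1) && parallel a b] a H by rewrite path_relI
  neqH pH.
by apply: sub_path => b c /= /andP[]; apply: parallel_next_step.
Qed.

Section Corridor.
Variable t : state D.

(** Each of the two sides of a stretch of blue steps is followed by one arc:
from the exit of [a] one reaches the exits of all the blue steps which come
next, and likewise for entries. *)
Lemma corridor_out a Q : path next_step a Q -> all (fun c => odd c.2) Q ->
  all (fun c => ~~ t c.1) Q -> connect (along t) (inl a) (inl (last a Q)).
Proof.
elim: Q a => [|c Q IHQ] a //= /andP[/andP[/eqP ac _] cQ].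
move=> /andP[oc oQ] /andP[tc tQ].
apply: connect_trans (IHQ c cQ oQ tQ);
  apply: connect_trans (connect1 (along_edge t a)) _.
by rewrite ac -(smoothing_blue oc tc) along_csym connect1 ?along_smoothing.
Qed.

Lemma corridor_in a Q : path next_step a Q ->
  all (fun c => odd c.2) (belast a Q) ->
  all (fun c => ~~ t c.1) (belast a Q) ->
  connect (along t) (inl (opp a)) (inl (opp (last a Q))).
Proof.
elim: Q a => [|c Q IHQ] a //= /andP[/andP[_ /eqP ac] cQ].
move=> /andP[oa oQ] /andP[ta tQ].
apply: connect_trans (IHQ c cQ oQ tQ); rewrite -ac.
apply: connect_trans (connect1 (along_edge _ _)); apply: connect1.
by rewrite -[a in turn a]opp_opp -(@smoothing_blue _ t (opp a)) ?odd_opp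
  ?along_smoothing.
Qed.

Variables (a b : dart D) (Q : seq (dart D)).
Hypothesis chainL : step_chain (a :: rcons Q b).
Hypotheses (t_a : t a.1) (t_b : t b.1) (t_Q : all (fun c => ~~ t c.1) Q).

Lemma between_connect : connect (along t) (inl a) (inl (opp b)).
Proof.
case/and3P: chainL => _ /= /andP[_ ]; rewrite all_rcons rcons_path.
case/andP=> ob oQ /andP[aQ /andP[/eqP Qb _]].
apply: connect_trans (corridor_out aQ oQ t_Q) _.
apply: connect_trans (connect1 (along_edge t _)) _.
by rewrite Qb -(@smoothing_red _ t (opp b)) ?odd_opp // along_csym connect1
  ?along_smoothing.
Qed.

(** The darts inside the ladder disc between the red steps [a] and [b]: those at
the exits of all the steps but [b] and those at the entries of all but [a]. *)
Let zone : pred (point D) := fun u => if u is inl d then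
  has (fun c => d \in [:: c; turn c]) (a :: Q)
  || has (fun c => d \in [:: opp c; turn (opp c)]) (rcons Q b) else false.

(** An edge goes from an exit to the next entry and back.  At a red step, an
arc stays at the exit or at the entry; at a blue step, which is strictly between
[a] and [b], both ends are in the zone. *)
Lemma zone_closed : closed (along t) zone.
Proof.
apply: (intro_closed (@along_csym _ t)).
(* Which end of an edge of the corridor belongs to which step. *)
have [next prev] :
  (forall c, c \in a :: Q -> exists2 c', c' \in rcons Q b & next_step c c') /\
  (forall c', c' \in rcons Q b -> exists2 c, c \in a :: Q & next_step c c').
  have: path next_step a (rcons Q b) by case/and3P: chainL.
  elim: (Q) (a) => [|e q IHq] d /= /andP[dr] => [_|/IHq[nx pr]].
    by split=> c; rewrite inE => /eqP->; [exists b|exists d]; rewrite ?mem_head.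
  split=> c; rewrite inE => /orP[/eqP->|]; first by exists e; rewrite ?mem_head.
    by case/nx=> c' c'q cc'; exists c'; rewrite // inE c'q orbT.
    by exists d; rewrite ?mem_head.
  by case/pr=> c' c'q cc'; exists c'; rewrite // inE c'q orbT.
have odds c : c \in a :: rcons Q b -> odd c.2.
  by case/and3P: chainL => _ /allP oL _ /oL.
move=> [d|//] [d'|//] /orP[]/eqP->; rewrite ![in _ \in zone]unfold_in /zone.
- case/orP=> /hasP[c].
    case/next=> c' c'Q /andP[/eqP E1 /eqP E2]; rewrite !inE => cd.
    apply/orP; right; apply/hasP; exists c' => //.
    by case/orP: cd => /eqP->; rewrite ?E1 ?E2 !inE eqxx ?orbT.
  case/prev=> c' c'Q /andP[/eqP E1 /eqP E2]; rewrite !inE => cd.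
  apply/orP; left; apply/hasP; exists c' => //.
  by case/orP: cd => /eqP->; rewrite -?E1 -?E2 edge_inv !inE eqxx ?orbT.
- case/orP=> /hasP[c cQ]; rewrite !inE => cd.
    have oc : odd c.2 by rewrite odds // -rcons_cons mem_rcons inE cQ orbT.
    have [tc|tc] := boolP (t c.1).
      have S := smoothing_red oc tc.
      apply/orP; left; apply/hasP; exists c => //.
      by case/orP: cd => /eqP->; rewrite -?S ?smoothing_inv !inE ?S eqxx ?orbT.
    have cQ' : c \in Q by move: cQ tc; rewrite inE => /orP[/eqP->|//];
      rewrite t_a.
    have S := smoothing_blue oc tc.
    apply/orP; right; apply/hasP; exists c;
      first by rewrite mem_rcons inE cQ' orbT.
    have S' : smoothing t (opp c) =
      turn c by rewrite smoothing_blue ?odd_opp // opp_opp.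
    by case/orP: cd => /eqP->; rewrite -?S' ?smoothing_inv !inE ?S eqxx ?orbT.
  have oc : odd c.2 by rewrite odds // inE cQ orbT.
  have oc' : odd (opp c).2 by rewrite odd_opp.
  have [tc|tc] := boolP (t c.1).
    have S := smoothing_red oc' tc.
    apply/orP; right; apply/hasP; exists c => //.
    by case/orP: cd => /eqP->; rewrite -?S ?smoothing_inv !inE ?S eqxx ?orbT.
  have cQ' : c \in Q by move: cQ tc; rewrite mem_rcons inE => /orP[/eqP->|//];
    rewrite t_b.
  have S := smoothing_blue oc tc.
  apply/orP; left; apply/hasP; exists c; first by rewrite inE cQ' orbT.
  have S' : smoothing t (opp c) =
    turn c by rewrite smoothing_blue ?odd_opp // opp_opp.
  by case/orP: cd => /eqP->; rewrite -?S ?smoothing_inv !inE ?S' eqxx ?orbT.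
Qed.

(** The zone contains the exit of [a] but not its entry, and the entry of [b]
but not its exit. *)
Lemma between_separate :
  ~~ connect (along t) (inl a) (inl (opp a)) /\
  ~~ connect (along t) (inl b) (inl (opp b)).
Proof.
have cl := closed_connect zone_closed.
case/and3P: chainL;
  rewrite /crossings_of /= map_rcons mem_rcons rcons_uniq inE negb_or.
case/and3P=> /andP[ab aQ] bQ _ _ _.
have out c d : c.1 != d.1 ->
  (c \in [:: d; turn d] = false) * (c \in [:: opp d; turn (opp d)] = false).
  by move=> cd; split; apply: contraNF cd; rewrite !inE => /orP[]/eqP->.
have outQ c : c.1 \notin [seq e.1 | e <- Q] ->
    (has (fun e => c \in [:: e; turn e]) Q = false) *
    (has (fun e => c \in [:: opp e; turn (opp e)]) Q = false).
  move=> cQ; split; apply/hasPn => d dQ; rewrite out //;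
  by apply: contraNneq cQ => ->; apply: map_f.
split; apply: contraL isT => /cl;
  rewrite ![in _ \in zone]unfold_in /zone /= !has_rcons.
  rewrite !outQ // ![in opp a \in [:: opp b; _]]out // !inE eqxx
    (negPf (opp_neq a)).
  by rewrite -[opp a == turn a]/(turn (turn a) == turn a) (negPf (turn_neq _)).
rewrite ![b \in [:: a; _]]out 1?eq_sym // !outQ // !inE eqxx.
by rewrite ![b == _]eq_sym (negPf (opp_neq b)) (negPf (turn_opp_neq b)) orbT.
Qed.

End Corridor.
End Ladders.

Section Reds.
Variable D : link_diagram.
Implicit Types (s t : state D) (x y : cro D) (a b c : dart D)
    (H r : seq (dart D)).

Definition reds t H := [seq a <- H | t a.1].

Lemma size_reds t H : size (reds t H) = count t (crossings_of H).
Proof. by rewrite size_filter count_map. Qed.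

Lemma step_chain_cat H1 H2 : step_chain (H1 ++ H2) ->
    step_chain H1 /\ step_chain H2.
Proof.
rewrite /step_chain /crossings_of map_cat cat_uniq all_cat.
by case/and3P=> /and3P[u1 _ u2] /andP[o1 o2] /cat_sorted2[p1 p2]; split;
  apply/and3P.
Qed.

Lemma reds_next t H r1 a b r2 : step_chain H ->
    reds t H = r1 ++ [:: a, b & r2] ->
  [/\ connect (along t) (inl a) (inl (opp b)),
      ~~ connect (along t) (inl a) (inl (opp a))
    & ~~ connect (along t) (inl b) (inl (opp b))].
Proof.
move=> strH /filter_eq_cat[H1 [H2 [EH _ /filter_eq_cons[q [s1 [EH2 _ ta]]]]]].
case/filter_eq_cons=> Q [s2 [Es Qb tb _]].
have [_ strH2] : step_chain (H1 ++ q) /\ step_chain (a :: rcons Q b ++ s2).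
  by apply: step_chain_cat; rewrite -catA cat_rcons -Es -EH2 -EH.
have [strL _] := step_chain_cat (H1 := a :: rcons Q b) strH2.
have [sa sb] := between_separate strL ta tb; split=> //.
exact: (between_connect strL tb Qb).
Qed.

Lemma reds_first t c H a r : step_chain (c :: H) -> reds t (c :: H) = a :: r ->
  connect (along t) (inl (opp c)) (inl (opp a)).
Proof.
move=> strH /filter_eq_cons[[|c' Q] [s' [/= [<- EH] bl ta _]]];
  first exact: connect0.
have : step_chain ((c :: rcons Q a) ++ s') by rewrite cat_cons cat_rcons -EH.
case/step_chain_cat=> /and3P[_ oL strL] _.
have allb P : all P (c :: Q) ->
  all P (belast c (rcons Q a)) by rewrite belast_rcons.
have := corridor_in (t := t) strL; rewrite last_rcons; apply; apply: allb.
  by move: oL; rewrite /= all_rcons => /and3P[-> _ ->].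
by move: bl.
Qed.

Lemma reds_last t c H a r : step_chain (c :: H) ->
    reds t (c :: H) = rcons r a ->
  connect (along t) (inl a) (inl (last c H)).
Proof.
rewrite -cats1 =>
  strH /filter_eq_cat[H1 [H2 [EH _ /filter_eq_cons[q [Q [EH2 _ ta]]]]]].
move/filter_eq_nil => Qb; rewrite {}EH2 in EH.
have -> : last c H = last a Q.
  have := congr1 (last a) EH; rewrite /= last_cat last_cat /= => <-.
  by [].
have : step_chain ((H1 ++ q) ++ (a :: Q)) by rewrite -catA -EH.
by case/step_chain_cat=> _ /and3P[_ /andP[_ oQ] aQ]; apply: corridor_out.
Qed.

(** One side of the step faces another red step, and the circle on this side is
confined between the two. *)
Lemma reds_separate t H a : step_chain H -> (1 < size (reds t H))%N ->
    a \in reds t H ->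
  ~~ connect (along t) (inl a) (inl (opp a)).
Proof.
move=> strH size_r a_r;
  case/splitPr Er: (reds t H) / a_r size_r => [r1 r2] size_r.
case: r2 => [|b r2] in Er size_r; last by case: (reds_next strH Er).
case/lastP: r1 => [|r1 b] in Er size_r; first by [].
by rewrite cat_rcons in Er; case: (reds_next strH Er).
Qed.

Lemma count_flip t x (xs : seq (cro D)) : uniq xs -> ~~ t x ->
  count (flip t x) xs = (count t xs + (x \in xs))%N.
Proof.
move=> + tx; elim: xs => //= y xs IHxs /andP[yxs /IHxs->].
rewrite inE ffunE [x == y]eq_sym; have [Eyx|_] /= := eqVneq y x;
  last by rewrite addnA.
by rewrite {}Eyx in yxs *; rewrite (negPf tx) (negPf yxs) add0n addn0 addnC.
Qed.

Lemma size_reds_flip t a H : step_chain H -> a \in H -> ~~ t a.1 ->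
  size (reds (flip t a.1) H) = (size (reds t H)).+1.
Proof.
move=> /and3P[uH _ _] aH ta; rewrite !size_reds count_flip //.
by rewrite map_f // addn1.
Qed.

End Reds.

(** * The periphery circle *)

Section Periphery.
Variables (D : link_diagram) (s0 : state D) (k : nat)
    (H : 'I_k -> seq (dart D)).
Implicit Types (s t : state D) (x y : cro D) (a b c : dart D).
Hypothesis chainH : forall i, step_chain (H i).
Hypothesis coverH : forall x, (x \in ladder_crossings H) = ~~ s0 x.

Lemma mem_ladder_crossings x :
  reflect (exists i, x \in crossings_of (H i)) (x \in ladder_crossings H).
Proof.
apply: (iffP flatten_mapP) => [[i _ xi]|[i xi]]; exists i => //;
  exact: mem_enum.
Qed.

(** Induction on the number of blue crossings.  Without any, the state is the
cut diagram and the claim is that the periphery number is one.  Otherwise make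
a blue step red: its ladder then has two red steps, so restoring the step merges
circles and preserves connections. *)
Lemma ends_connected t i c r : H i = c :: r -> #|periphery s0 H i| = 1%N ->
  (forall x, s0 x -> t x) -> (forall l, reds t (H l) != [::]) ->
  connect (along t) (inl (opp c)) (inl (last c r)).
Proof.
move=> EHi per1; have [n] := ubnP #|[set x | ~~ t x]|;
  elim: n t => // n IHn t le_n s0t redt.
have [x tx|no_blue] := pickP [pred x | ~~ t x].
  have : x \in ladder_crossings H by rewrite coverH; apply: contra tx;
    apply: s0t.
  case/mem_ladder_crossings=> l /mapP[a aHl Ex]; rewrite /= Ex in tx.
  have oa : odd a.2 by case/and3P: (chainH l) => _ /allP/(_ _ aHl).
  have ta' : flip t a.1 a.1 by rewrite flip_at.
  rewrite -[t](flipK a.1); apply: connect_merge1 => //.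
    apply: (reds_separate (chainH l)); last by rewrite mem_filter ta'.
    by rewrite size_reds_flip // ltnS lt0n size_eq0.
  apply: IHn => [|y /s0t ty|j].
  - move: le_n; rewrite (cardsD1 a.1) inE tx ltnS add1n; apply: leq_ltn_trans.
    by apply/subset_leq_card/subsetP => y; rewrite !inE ffunE;
      case: eqP => [->|]; rewrite ?(negPf tx).
  - by rewrite ffunE ty addbT; apply: contraNneq tx => <-.
  - move: (redt j); rewrite -!size_eq0 -!lt0n !size_reds => /leq_trans-> //.
    rewrite count_flip ?leq_addr //; by case/and3P: (chainH j).
have Ecut : cut s0 H = t.
  by apply/ffunP => x; rewrite ffunE coverH orbN; have /negbFE-> := no_blue x.
rewrite -circle_eq; move: per1; rewrite /periphery EHi Ecut /=.
rewrite (_ : [set C | _] =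
  [set circle t (inl (opp c)); circle t (inl (last c r))]).
  by rewrite cards2; case: eqP.
by apply/setP => C; rewrite !inE.
Qed.

End Periphery.

(** * States and their numbers of red steps *)

Section Lists.

Lemma uniq_flatten_eq (I T : eqType) (f : I -> seq T) (s : seq I) i j x :
  uniq (flatten [seq f l | l <- s]) -> i \in s -> j \in s ->
  x \in f i -> x \in f j -> i = j.
Proof.
elim: s => //= l s IHs; rewrite cat_uniq => /and3P[_ /hasPn dis /IHs{}IHs].
have out j' y : j' \in s -> y \in f j' -> y \notin f l.
  by move=> j's yj'; apply: dis; apply/flatten_mapP; exists j'.
rewrite !inE => /predU1P[->|si] /predU1P[->|sj] //; last exact: IHs.
  by move=> xl /(out _ _ sj); rewrite xl.
by move=> /(out _ _ si) /negPf->.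
Qed.

Lemma enum_ord_split k (i : 'I_k) e1 e2 : enum 'I_k = e1 ++ i :: e2 ->
  forall F : 'I_k -> nat, (\sum_(l <- e1) F l = \sum_(l < k | (l < i)%N) F l)%N.
Proof.
move=> Ee F; have : pairwise (fun l m : 'I_k => (l < m)%N) (enum 'I_k).
  by rewrite -(pairwise_map val ltn) val_enum_ord -sorted_pairwise
    ?iota_ltn_sorted //; apply: ltn_trans.
rewrite Ee pairwise_cat /= => /and3P[/allrelP lt1 _ /andP[/allP lt2 _]].
transitivity (\sum_(l <- enum 'I_k | (l < i)%N) F l)%N;
  last by rewrite big_enum_cond.
rewrite -[RHS]big_filter Ee filter_cat /= ltnn.
rewrite (all_filterP _); last by apply/allP => l e1l; apply: lt1;
  rewrite ?mem_head.
rewrite (eq_in_filter (a2 := pred0)) ?filter_pred0 ?cats0 // => l /lt2 il.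
by rewrite ltnNge ltnW.
Qed.

Lemma alternating_telescope (R : pzRingType) (V : lmodType R) (T : Type)
    (f g : T -> V) (a x0 : T) (r : seq T) :
  (forall r1 b c r2, a :: r = r1 ++ [:: b, c & r2] -> f b = g c) ->
  \sum_(j < (size r).+1) (-1) ^+ j *:
    (f (nth x0 (a :: r) j) + g (nth x0 (a :: r) j)) =
    g a + (-1) ^+ size r *: f (last a r).
Proof.
elim: r a => [|b r IHr] a fg; first by rewrite big_ord1 !expr0 !scale1r addrC.
rewrite big_ord_recl expr0 scale1r /=.
under eq_bigr => j _ do rewrite exprS -scalerA scaleN1r.
rewrite sumrN IHr; last by move=> r1 c c' r2 Er; apply: (fg (a :: r1) c c' r2);
  rewrite Er.
by rewrite (fg [::] a b r) // exprS mulN1r scaleNr opprD addrA addrAC -addrA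
  addrC -!addrA addKr addrC.
Qed.

Lemma previous_B_cat (D : pre_diagram) (P Q : seq (cro D)) x (s : state D) :
  uniq (P ++ x :: Q) -> previous_B (P ++ x :: Q) x s = count s P.
Proof.
rewrite cat_uniq /= => /and3P[uP /norP[xP _] _].
rewrite /previous_B -size_filter -(card_uniqP _) ?filter_uniq //.
apply: eq_card => y; rewrite inE mem_filter; congr andb.
rewrite !index_cat (negPf xP) /= eqxx addn0.
by case: ifP => [yP|_]; rewrite ?index_mem // ltnNge leq_addr.
Qed.

End Lists.

Section States.
Variables (D : link_diagram) (s0 : state D) (k : nat)
    (H : 'I_k -> seq (dart D)).
Implicit Types (s t : state D) (x y : cro D) (a b c : dart D).
Implicit Types (M : {ffun 'I_k -> {set cro D}}) (nu mu : 'I_k -> nat).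
Hypothesis chainH : forall i, step_chain (H i).
Hypothesis coverH : forall x, (x \in ladder_crossings H) = ~~ s0 x.
Hypothesis uniqH : uniq (ladder_crossings H).

Definition with_reds nu t :=
  [forall x, s0 x ==> t x] && [forall i, size (reds t (H i)) == nu i].

Lemma with_redsP nu t : reflect
  ((forall x, s0 x -> t x) /\ (forall i, size (reds t (H i)) = nu i))
    (with_reds nu t).
Proof.
apply: (iffP andP) => [[/forallP s0t /forallP tnu]|[s0t tnu]].
  by split=> [x|i]; [apply/implyP|apply/eqP].
by split; [apply/forallP => x; apply/implyP/s0t|apply/forallP => i; apply/eqP].
Qed.

Lemma same_ladder i j x :
  x \in crossings_of (H i) -> x \in crossings_of (H j) -> i = j.
Proof. by apply: uniq_flatten_eq uniqH _ _; rewrite mem_enum. Qed.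

Lemma ladder_blue i x : x \in crossings_of (H i) -> ~~ s0 x.
Proof. by move=> xi; rewrite -coverH; apply/mem_ladder_crossings; exists i. Qed.

(** Together with [redden s0], a bijection between the choices of steps and the
states with prescribed numbers of red steps. *)
Definition chosen t : {ffun 'I_k -> {set cro D}} :=
  [ffun i => [set x in crossings_of (H i) | t x]].

Lemma redden_in nu M i x : choice_of H nu M -> x \in crossings_of (H i) ->
  redden s0 M x = (x \in M i).
Proof.
move=> /forallP HM xi; rewrite ffunE (negPf (ladder_blue xi)) /=.
apply/existsP/idP => [[j xj]|]; last by exists i.
have /andP[/subsetP/(_ _ xj) xHj _] := HM j.
by rewrite (same_ladder xi xHj).
Qed.

Lemma chosenK nu M : choice_of H nu M -> chosen (redden s0 M) = M.
Proof.
move=> HM; apply/ffunP => i; apply/setP => x; rewrite [chosen _ _]ffunE inE.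
have [xi|xi] := boolP (x \in crossings_of (H i)); first exact: redden_in HM xi.
have /andP[/subsetP MH _] := forallP HM i.
by apply/esym; apply: contraNF xi => /MH.
Qed.

Lemma choice_chosen nu t :
  choice_of H nu (chosen t) && (redden s0 (chosen t) == t) = with_reds nu t.
Proof.
have card_chosen i : #|chosen t i| = size (reds t (H i)).
  rewrite size_reds -size_filter ffunE -(card_uniqP _).
    by rewrite cardsE; apply: eq_card => x; rewrite mem_filter !unfold_in andbC.
  by rewrite filter_uniq //; case/and3P: (chainH i).
have sub i : chosen t i \subset crossings_of (H i).
  by apply/subsetP => x; rewrite ffunE inE => /andP[].
rewrite andbC; congr andb.
  apply/eqP/forallP => [<- x|s0t].
    by apply/implyP => s0x; rewrite ffunE s0x.
  apply/ffunP => x; rewrite ffunE; have [s0x|s0x] /= := boolP (s0 x).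
    by rewrite (implyP (s0t x)).
  apply/existsP/idP => [[i]|tx]; first by rewrite ffunE inE => /andP[].
  by move: s0x; rewrite -coverH => /mem_ladder_crossings[i xi]; exists i;
    rewrite ffunE inE xi.
by apply: eq_forallb => i; rewrite sub card_chosen.
Qed.

Lemma sum_choices (V : zmodType) nu (G : state D -> V) :
  \sum_(M | choice_of H nu M) G (redden s0 M) = \sum_(t | with_reds nu t) G t.
Proof.
rewrite (reindex_onto chosen (redden s0)) /=; last exact: chosenK.
by apply: eq_big => [t|t /andP[_ /eqP->] //]; exact: choice_chosen.
Qed.

Definition first_circle t i :=
  if reds t (H i) is a :: _ then circle t (inl (opp a)) else set0.

Lemma circle0E nu M i : choice_of H nu M ->
    circle0 s0 H M i = first_circle (redden s0 M) i.
Proof.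
move=> HM; rewrite /circle0 /first_circle /reds;
  congr (if _ is a :: _ then _ else _).
by apply: eq_in_filter => a aHi; rewrite -(redden_in HM) // map_f.
Qed.

Definition incr_at i mu l := if l == i then (1 + mu l)%N else mu l.

Lemma with_reds_flip mu i a t : a \in H i -> t a.1 ->
  with_reds mu (flip t a.1) = with_reds (incr_at i mu) t.
Proof.
move=> aHi ta; set s := flip t a.1; have sa : ~~ s a.1 by rewrite flip_at ta.
have a1i : a.1 \in crossings_of (H i) by apply: map_f.
congr andb.
  apply/eq_forallb => x; rewrite ffunE; case: eqP => // ->.
  by rewrite (negPf (ladder_blue a1i)).
apply: eq_forallb => l; rewrite -[t](flipK a.1) -/s; clearbody s.
rewrite !size_reds count_flip //; last first.
  by case/and3P: (chainH l).
rewrite /incr_at; have [->|li] := eqVneq l i;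
  first by rewrite a1i addn1 add1n eqSS.
rewrite (_ : _ \in _ = false) ?addn0 //.
by apply: contraNF li => a1l; rewrite (same_ladder a1l a1i).
Qed.

(** The red steps previous to the [j]-th red step of the ladder [i], counted
from zero, are [mu l] in each earlier ladder [l], since [incr_at i mu] differs
from [mu] at [i] only, and [j] in the ladder [i] itself. *)
Lemma previous_B_step mu i t rest (d0 : dart D) j :
  let r := reds t (H i) in let a := nth d0 r j in
  uniq (ladder_crossings H ++ rest) -> with_reds (incr_at i mu) t ->
  (j < size r)%N ->
  previous_B (ladder_crossings H ++ rest) a.1 (flip t a.1) =
    (\sum_(l < k | (l < i)%N) mu l + j)%N.
Proof.
move=> r a uniq_num /with_redsP[_ tmu] ltj.
have : reds t (H i) =
  take j r ++ a :: drop j.+1 r by rewrite -drop_nth ?cat_take_drop.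
case/filter_eq_cat=> h1 [h2 [EH Er1 /filter_eq_cons[q [h3 [Eh2 q0 ta _]]]]].
have := mem_enum 'I_k i; case/splitPr Ee: _ / => [e1 e2].
pose P := flatten [seq crossings_of (H l) | l <- e1] ++ crossings_of (h1 ++ q).
have Enum : exists Q, ladder_crossings H ++ rest = P ++ a.1 :: Q.
  eexists; rewrite /ladder_crossings Ee map_cat flatten_cat /= EH
    Eh2 /P /crossings_of !map_cat /=.
  by rewrite -!catA /=; reflexivity.
case: Enum uniq_num => Q -> uniq_num; rewrite previous_B_cat //.
have aP : a.1 \notin P by move: uniq_num;
  rewrite cat_uniq /= => /and3P[_ /norP[]].
have uP : uniq P by move: uniq_num; rewrite cat_uniq => /andP[].
have /(count_flip uP) : ~~ flip t a.1 a.1 by rewrite flip_at ta.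
rewrite flipK (negPf aP) addn0 => <-; rewrite /P count_cat; congr addn.
  rewrite count_flatten -map_comp sumnE big_map -(enum_ord_split Ee).
  have uE : uniq (e1 ++ i :: e2) by rewrite -Ee enum_uniq.
  rewrite !big_seq; apply: eq_bigr => l le1; rewrite /= -size_reds tmu /incr_at.
  have [li|//] := eqVneq l i.
  by move: uE; rewrite cat_uniq /= -li le1 andbF.
rewrite -size_reds /reds filter_cat Er1; move: q0.
rewrite all_predC has_filter negbK => /eqP->.
by rewrite cats0 size_take ltj.
Qed.

End States.

(** * The differential of an all-plus state *)

Lemma sum_pair (V : nmodType) (T : finType) (w1 w2 : T) (F : T -> V) :
  w1 != w2 ->
  \sum_(w | (w == w1) || (w == w2)) F w = F w1 + F w2.
Proof.
move=> w12; rewrite (bigD1 w1) ?eqxx //= (bigD1 w2) ?eqxx ?orbT 1?eq_sym //=.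
by rewrite big_pred0 ?addr0 // => w; do 2!case: (w == _).
Qed.

Lemma sum_support (V : nmodType) (T : finType) (xs : seq T) (F : T -> V) :
  uniq xs -> (forall x, x \notin xs -> F x = 0) ->
  \sum_x F x = \sum_(x <- xs) F x.
Proof.
move=> uxs F0; rewrite [RHS]big_uniq // (bigID (mem xs)) /=.
by rewrite [X in _ + X]big1 ?addr0.
Qed.

Lemma d_sum_gen (R : comNzRingType) (D : pre_diagram) (num : seq (cro D))
    (I : finType) (P : pred I) (f : I -> enhanced D) :
  d num (\sum_(i | P i) gen R (f i)) = \sum_(i | P i) d_gen R num (f i).
Proof.
rewrite /d; under eq_bigr => u _ do rewrite sum_ffunE scaler_suml.
rewrite exchange_big; apply: eq_bigr => i _.
rewrite (bigD1 (f i)) //= ffunE eqxx scale1r big1 ?addr0 // => u ufi.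
by rewrite ffunE (negPf ufi) scale0r.
Qed.

Section Chains.
Variables (R : comNzRingType) (D : link_diagram) (V : lmodType R).
Variable e : enhanced D -> V.
Implicit Types (s t : state D) (x y : cro D) (a b c : dart D).

(** The differential of a generator, with the generators sent by [e] to an
arbitrary module: the cancellations are between equal generators, whatever these
are. *)
Definition boundary (num : seq (cro D)) (u : enhanced D) : V :=
  \sum_x \sum_(t | adjacent x u t) (-1) ^+ previous_B num x (st u) *: e t.

Definition gen_minus t a : V := e (all_plus_but t (circle t (inl a))).

Lemma gen_minus_connect t a b : connect (along t) (inl a) (inl b) ->
  gen_minus t a = gen_minus t b.
Proof. by rewrite -circle_eq /gen_minus => /eqP->. Qed.

Lemma boundary_at (num : seq (cro D)) t a : odd a.2 -> t a.1 ->
  ~~ connect (along t) (inl a) (inl (opp a)) ->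
  forall z : R, \sum_(w | adjacent a.1 (all_plus (flip t a.1)) w) z *: e w =
    z *: (gen_minus t a + gen_minus t (opp a)).
Proof.
move=> oa ta sep z; rewrite -scaler_sumr; congr (_ *: _).
rewrite /gen_minus; under eq_bigl => w do rewrite adjacent_merge //.
set w1 := all_plus_but t _; set w2 := all_plus_but t _.
have w12 : w1 != w2.
  apply/eqP => /esym/(congr1 (@plus _)) /setP/(_ (circle t (inl a))).
  by rewrite !inE eqxx circle_in circle_eq sep.
exact: sum_pair.
Qed.

Section Ladders.
Variables (s0 : state D) (k : nat) (H : 'I_k -> seq (dart D))
    (rest : seq (cro D)).
Implicit Type (mu : 'I_k -> nat).
Hypothesis chainH : forall i, step_chain (H i).
Hypothesis coverH : forall x, (x \in ladder_crossings H) = ~~ s0 x.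
Hypothesis uniq_num : uniq (ladder_crossings H ++ rest).
Hypothesis periphery1 : forall i, #|periphery s0 H i| = 1%N.

Let num := ladder_crossings H ++ rest.

Let uniqH : uniq (ladder_crossings H).
Proof. by move: uniq_num; rewrite cat_uniq => /andP[]. Qed.

Let oddH i a : a \in H i -> odd a.2.
Proof. by case/and3P: (chainH i) => _ /allP oH _ /oH. Qed.

Lemma boundary_steps mu s : (forall i, 0 < mu i)%N -> with_reds s0 H mu s ->
  boundary num (all_plus s) =
    \sum_i \sum_(a <- H i | ~~ s a.1) (-1) ^+ previous_B num a.1 s *:
      (gen_minus (flip s a.1) a + gen_minus (flip s a.1) (opp a)).
Proof.
move=> mu_gt0 /with_redsP[s0s smu].
pose G x := \sum_(t | adjacent x (all_plus s) t) (-1) ^+ previous_B num x s *: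
  e t.
have G0 x : s x -> G x = 0.
  by move=> sx; rewrite /G big_pred0 // => w; apply/and5P=> -[_ _];
    rewrite /= /st /= sx.
rewrite /boundary -/G (sum_support (F := G) uniqH); last first.
  by move=> x; rewrite coverH negbK => /s0s; exact: G0.
rewrite big_flatten big_map big_enum; apply: eq_bigr => i _.
rewrite big_map [RHS]big_mkcond /= !big_seq; apply: eq_bigr => a aHi.
case: ifPn => [sa|]; last by rewrite negbK => /G0.
have sep : ~~ connect (along (flip s a.1)) (inl a) (inl (opp a)).
  apply: (reds_separate (chainH i)); last by rewrite mem_filter aHi flip_at sa.
  by rewrite size_reds_flip // ltnS smu.
have ta : flip s a.1 a.1 by rewrite flip_at.
by rewrite /G -(boundary_at num (oddH aHi) ta sep) flipK.
Qed.

(** The exit of a red step and the entry of the next one are on the same circle,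
hence the sum telescopes to the first and the last circles, which are equal by
[ends_connected]. *)
Lemma sum_reds mu i t : (forall l, 0 < mu l)%N ->
    with_reds s0 H (incr_at i mu) t ->
  \sum_(a <- reds t (H i)) (-1) ^+ previous_B num a.1 (flip t a.1) *:
      (gen_minus t a + gen_minus t (opp a)) =
  if odd (mu i) then 0 else
    ((-1) ^+ (\sum_(l < k | (l < i)%N) mu l)%N *:
      e (all_plus_but t (first_circle H t i))) *+ 2.
Proof.
move=> mu_gt0 tmu; have [s0t tmu'] := with_redsP _ _ _ _ tmu.
have redt l : reds t (H l) != [::].
  by rewrite -size_eq0 tmu' /incr_at -lt0n; case: ifP.
have size_r := tmu' i; rewrite /incr_at eqxx in size_r.
case Er : (reds t (H i)) size_r => [//|a r] /= [size_r].
case EH : (H i) (Er) => [//|c h] Er'.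
have prevE j : (j < size (a :: r))%N ->
    previous_B num (nth a (a :: r) j).1 (flip t (nth a (a :: r) j).1) =
    (\sum_(l < k | (l < i)%N) mu l + j)%N.
  by rewrite -Er; apply: (previous_B_step a uniq_num tmu).
rewrite (big_nth a) big_mkord.
rewrite (eq_bigr
  (fun j : 'I_(size r).+1 => (-1) ^+ (\sum_(l < k | (l < i)%N) mu l)%N *:
    ((-1) ^+ j *: (gen_minus t (nth a (a :: r) j) +
      gen_minus t (opp (nth a (a :: r) j))))));
  last by move=> j _; rewrite scalerA -exprD; congr (_ ^+ _ *: _); apply: prevE.
rewrite -scaler_sumr
  (alternating_telescope (f := gen_minus t)
  (g := fun b => gen_minus t (opp b))); last first.
  move=> r1 b b' r2 Er2; apply: gen_minus_connect.
  by rewrite Er2 in Er; case: (reds_next (chainH i) Er).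
have -> : gen_minus t (last a r) = gen_minus t (opp a).
  have strH := chainH i; rewrite EH in strH.
  apply/esym/gen_minus_connect.
  have := ends_connected chainH coverH EH (periphery1 i) s0t redt.
  rewrite (same_connect (@along_csym _ t) (reds_first strH Er')) =>
    /connect_trans; apply.
  by rewrite along_csym; apply: (reds_last (r := belast a r) strH);
    rewrite Er' lastI.
rewrite /first_circle Er size_r add0n -(signr_odd _ (mu i)) /=
  -/(gen_minus t (opp a)).
case: odd; first by rewrite expr1 scaleN1r subrr scaler0.
by rewrite expr0 scale1r -mulr2n scalerMnr.
Qed.

(** The pairs of a state with [mu i] red steps in the ladder [i] and a blue step
of this ladder correspond, by changing this step, to the pairs of a state with
one more red step and a red step of this ladder. *)
Lemma boundary_sum_plus mu : (forall i, 0 < mu i)%N ->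
  \sum_(M | choice_of H mu M) boundary num (all_plus (redden s0 M)) =
  (\sum_(i < k | ~~ odd (mu i) && (mu i < size (H i))%N)
    (-1) ^+ (\sum_(l < k | (l < i)%N) mu l)%N *:
      \sum_(M | choice_of H (incr_at i mu) M)
        e (all_plus_but (redden s0 M) (circle0 s0 H M i))) *+ 2.
Proof.
move=> mu_gt0.
rewrite (sum_choices chainH coverH uniqH mu
  (fun t => boundary num (all_plus t))).
rewrite (eq_bigr _ (fun s => boundary_steps mu_gt0)) exchange_big /=.
rewrite -sumrMnl [RHS]big_mkcond /=; apply: eq_bigr => i _.
rewrite (exchange_big_dep predT) //= big_seq.
under eq_bigr => a aHi.
  rewrite (reindex_inj (inv_inj (flipK a.1))).
  rewrite (eq_bigl (fun t => with_reds s0 H (incr_at i mu) t && t a.1));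
    last first.
    move=> t; rewrite flip_at negbK; case: (boolP (t a.1)) => ta;
      last by rewrite !andbF.
    by rewrite (with_reds_flip chainH coverH uniqH mu aHi ta).
  under eq_bigr => t _ do rewrite flipK.
  over.
rewrite -big_seq -(exchange_big_dep predT) //=.
under eq_bigr =>
  t tmu do rewrite -big_filter -/(reds t (H i)) (sum_reds mu_gt0 tmu).
case: (boolP (odd (mu i))) => /= [_|_]; first by rewrite big1.
case: ifPn => [mu_lt|]; last first.
  (* A ladder whose steps are all red offers no step to change. *)
  rewrite -leqNgt => mu_ge; rewrite big_pred0 // => t; apply/negbTE.
  apply/negP => /with_redsP[_ /(_ i)] size_r.
  have := size_filter (fun a => t a.1) (H i);
    rewrite -/(reds t _) size_r /incr_at eqxx.
  have := count_size (fun a => t a.1) (H i); lia.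
rewrite sumrMnl -scaler_sumr; congr (_ *: _ *+ 2).
rewrite -(sum_choices chainH coverH uniqH _
  (fun t => e (all_plus_but t (first_circle H t i)))).
by apply: eq_bigr => M HM; rewrite (circle0E coverH uniqH i HM).
Qed.

End Ladders.
End Chains.

(** * Nonvanishing and conclusion *)

Section Nonzero.
Variables (D : link_diagram) (s0 : state D) (k : nat)
    (H : 'I_k -> seq (dart D)).
Implicit Types (t : state D) (mu nu : 'I_k -> nat).
Hypothesis chainH : forall i, step_chain (H i).
Hypothesis coverH : forall x, (x \in ladder_crossings H) = ~~ s0 x.
Hypothesis uniqH : uniq (ladder_crossings H).

(** Make the first [nu i] steps of each ladder red. *)
Lemma with_reds_exists nu : (forall i, nu i <= size (H i))%N ->
  exists t, with_reds s0 H nu t.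
Proof.
move=> nu_le; pose first_steps i := take (nu i) (crossings_of (H i)).
exists [ffun x => s0 x || [exists i, x \in first_steps i]].
apply/with_redsP; split=> [x s0x|i]; first by rewrite ffunE s0x.
have uHi : uniq (crossings_of (H i)) by case/and3P: (chainH i).
have size_i : size (first_steps i) =
  nu i by rewrite size_take_min size_map (minn_idPl _).
rewrite size_reds -size_filter -size_i; congr size.
rewrite [RHS](subseq_uniqP uHi (take_subseq _ _)); apply: eq_in_filter => x xi.
rewrite ffunE (negPf (ladder_blue coverH xi)) /=.
apply/existsP/idP => [[j xj]|]; last by exists i.
by rewrite (same_ladder uniqH xi (mem_take xj)).
Qed.

(** A state with [incr_at r mu] red steps has [1 + mu r] of them in the ladder
[r], which excludes [incr_at i mu] for any other [i]. *)
Lemma coef_sum_minus0 (R : comNzRingType) mu i r t :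
  with_reds s0 H (incr_at r mu) t ->
  sum_minus0 R s0 H (incr_at i mu) i (all_plus_but t (first_circle H t r)) =
    (i == r)%:R.
Proof.
move=> tr; have -> : sum_minus0 R s0 H (incr_at i mu) i =
    \sum_(t' | with_reds s0 H (incr_at i mu) t') gen R
      (all_plus_but t' (first_circle H t' i)).
  rewrite -(sum_choices chainH coverH uniqH _
    (fun t => gen R (all_plus_but t (first_circle H t i)))).
  by apply: eq_bigr => M HM; rewrite (circle0E coverH uniqH i HM).
rewrite sum_ffunE; under eq_bigr => t' _ do rewrite ffunE.
have st_neq t' : t' != t ->
    (all_plus_but t (first_circle H t r) ==
      all_plus_but t' (first_circle H t' i)) = false.
  by apply: contraNF => /eqP/(congr1 (@st D)); rewrite /st /= => ->.
have [ir|ir] := eqVneq i r.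
  rewrite ir in st_neq *;
    rewrite (bigD1 t) //= eqxx big1 ?addr0 // => t' /andP[_ t't].
  by rewrite st_neq.
rewrite big1 // => t' t'i; rewrite st_neq //; apply: contraNneq ir => Et.
have [_ /(_ i)] := with_redsP _ _ _ _ t'i;
  have [_ /(_ i)] := with_redsP _ _ _ _ tr.
by rewrite Et => ->; rewrite /incr_at eqxx; case: eqVneq => // _ /eqP;
  rewrite add1n eq_sym -[_ == _]negbK neq_ltn ltnSn orbT.
Qed.

End Nonzero.

Theorem proposition4 (R : comNzRingType) (D : link_diagram) (s0 : state D)
    (k : nat) (H : 'I_k -> seq (dart D)) (rest : seq (cro D))
    (mu : 'I_k -> nat) :
  let num := ladder_crossings H ++ rest in
  (forall i, ladder s0 (H i)) ->
  perm_eq (ladder_crossings H) [seq x <- enum (cro D) | ~~ s0 x] ->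
  perm_eq num (enum (cro D)) ->
  (forall i, #|periphery s0 H i| = 1%N) ->
  (forall i, (0 < mu i <= size (H i))%N) ->
  let X := sum_plus R s0 H mu in
  let V := \sum_(i < k | ~~ odd (mu i) && (mu i < size (H i))%N)
    (-1) ^+ (\sum_(l < k | (l < i)%N) mu l)%N *:
      sum_minus0 R s0 H (fun l => if l == i then (1 + mu l)%N else mu l) i in
  d num X = V *+ 2 /\
  (V != 0 <-> exists r : 'I_k, ~~ odd (mu r) /\ (mu r < size (H r))%N).
Proof.
move=> num ladderH blueH permH per1 mu_range X V.
have chainH i : step_chain (H i) by have [/ladder_step_chain] := ladderH i.
have coverH x : (x \in ladder_crossings H) = ~~ s0 x.
  by rewrite (perm_mem blueH) mem_filter mem_enum andbT.
have uniq_num : uniq num by rewrite (perm_uniq permH) enum_uniq.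
have mu_gt0 i : (0 < mu i)%N by case/andP: (mu_range i).
split.
  by rewrite /X /sum_plus d_sum_gen
    (boundary_sum_plus (gen R) chainH coverH uniq_num per1 mu_gt0).
split=> [V0|[r [odd_r mu_r]]].
  have [r /andP[odd_r mu_r]|none] :=
    pickP (fun r => ~~ odd (mu r) && (mu r < size (H r))%N).
    by exists r.
  by case/eqP: V0; rewrite /V big_pred0.
have uniqH : uniq (ladder_crossings H) by move: uniq_num;
  rewrite cat_uniq => /andP[].
have [t tr] : exists t, with_reds s0 H (incr_at r mu) t.
  apply: (with_reds_exists chainH coverH uniqH) => i; rewrite /incr_at.
  by case: eqP => [->|_] //; case/andP: (mu_range i).
have coefE : V (all_plus_but t (first_circle H t r)) =
  (-1) ^+ (\sum_(l < k | (l < r)%N) mu l)%N.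
  rewrite /V sum_ffunE (bigD1 r) ?odd_r //= [X in _ + X]big1 ?addr0 =>
    [|i /andP[_ ir]].
    by rewrite ffunE (coef_sum_minus0 chainH coverH uniqH R r tr)
      eqxx /GRing.scale /= mulr1.
  by rewrite ffunE (coef_sum_minus0 chainH coverH uniqH R i tr) (negPf ir)
    scaler0.
apply: contraTneq (oner_neq0 R) => V0.
rewrite -(sqrr_sign R (\sum_(l < k | (l < r)%N) mu l)) -coefE V0.
by rewrite ffunE expr0n eqxx.
Qed.
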